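(* Let $\mathfrak{p}$ be a nonzero divided prime ideal of a subtractive semiring $S$ and let $\mathfrak{a}$ be an ideal of $S$ such that $\sqrt{\mathfrak{a}}=\mathfrak{p}$. Then the following statements are equivalent: (1) $\mathfrak{a}$ is a 2-absorbing ideal of $S$; (2) $\mathfrak{a}$ is a $\mathfrak{p}$-primary ideal of $S$ such that $\mathfrak{p}^2\subseteq\mathfrak{a}$.
   Context: A semiring is a set $S$ with operations $+,\cdot$ and elements $0\neq 1$ such that $(S,+,0)$ is a commutative monoid, $(S,\cdot,1)$ is a monoid, multiplication distributes over addition on both sides, and $a\cdot 0=0\cdot a=0$ for all $a\in S$. All semirings are assumed commutative (multiplication is commutative). An ideal of $S$ is a nonempty subset $\mathfrak{a}$ closed under addition with $sx\in\mathfrak{a}$ for all $s\in S$, $x\in\mathfrak{a}$; it is proper if $\mathfrak{a}\neq S$; $(x)$ is the principal ideal generated by $x$. The product of ideals is $IJ=\{\sum_{i=1}^n a_ib_i : a_i\in I,\ b_i\in J,\ n\in\mathbb{N}\}$, and $\mathfrak{p}^2=\mathfrak{p}\mathfrak{p}$. The radical is $\sqrt{\mathfrak{a}}=\{s\in S: s^n\in\mathfrak{a}\text{ for some } n\in\mathbb{N}\}$. An ideal $\mathfrak{a}$ is subtractive if $x+y\in\mathfrak{a}$ and $x\in\mathfrak{a}$ imply $y\in\mathfrak{a}$ for all $x,y\in S$; $S$ is subtractive if every ideal of $S$ is subtractive. A proper ideal $\mathfrak{p}$ is prime if $ab\in\mathfrak{p}$ implies $a\in\mathfrak{p}$ or $b\in\mathfrak{p}$.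 A prime ideal $\mathfrak{p}$ is divided if $\mathfrak{p}\subsetneq(x)$ for every $x\in S\setminus\mathfrak{p}$. A proper ideal $\mathfrak{q}$ is primary if $xy\in\mathfrak{q}$ implies $x\in\mathfrak{q}$ or $y^n\in\mathfrak{q}$ for some $n\in\mathbb{N}$; it is $\mathfrak{p}$-primary if it is primary and $\sqrt{\mathfrak{q}}=\mathfrak{p}$. A proper ideal $\mathfrak{a}$ is 2-absorbing if, for $x,y,z\in S$, $xyz\in\mathfrak{a}$ implies $xy\in\mathfrak{a}$ or $yz\in\mathfrak{a}$ or $xz\in\mathfrak{a}$. *)

(* Defs.v *)
From HB Require Import structures.
From mathcomp Require Import all_boot all_order all_algebra.
From mathcomp Require Import boolp classical_sets.

Set Implicit Arguments.
Unset Strict Implicit.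
Unset Printing Implicit Defensive.

Import GRing.Theory.
Local Open Scope ring_scope.
Local Open Scope classical_set_scope.

(* MathComp's [idealr] is restricted to proper decidable ideals of rings, hence
   the following definitions for arbitrary subsets of a semiring. *)
Section SemiringIdeals.
Variable S : comNzSemiRingType.
Implicit Types (a b p q I J : set S) (x y z s : S).

Definition ideal a : Prop :=
  [/\ a !=set0,
      (forall x y, a x -> a y -> a (x + y)) &
      (forall s x, a x -> a (s * x))].

Definition proper_ideal a : Prop := ideal a /\ a <> setT.

Definition principal_ideal x : set S := [set s * x | s in [set: S]].

Definition ideal_prod I J : set S :=
  [set z | exists (n : nat) (u v : 'I_n -> S),
     [/\ forall i, I (u i), forall i, J (v i) & z = \sum_(i < n) u i * v i]].

(* Here and in [primary_ideal] the exponent may be 0: since s ^+ 0 = 1, this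
   changes neither the radical of an ideal nor the notion of primary ideal. *)
Definition radical a : set S := [set s | exists n : nat, a (s ^+ n)].

Definition subtractive_ideal a : Prop :=
  ideal a /\ (forall x y, a (x + y) -> a x -> a y).

Definition prime_ideal p : Prop :=
  proper_ideal p /\ (forall x y, p (x * y) -> p x \/ p y).

Definition divided_prime_ideal p : Prop :=
  prime_ideal p /\ (forall x, ~ p x -> p `<` principal_ideal x).

Definition primary_ideal q : Prop :=
  proper_ideal q /\
  (forall x y, q (x * y) -> q x \/ exists n : nat, q (y ^+ n)).

Definition primary_ideal_for p q : Prop := primary_ideal q /\ radical q = p.

Definition two_absorbing_ideal a : Prop :=
  proper_ideal a /\
  (forall x y z, a (x * y * z) -> [\/ a (x * y), a (y * z) | a (x * z)]).

End SemiringIdeals.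

Definition subtractive_semiring (S : comNzSemiRingType) : Prop :=
  forall a : set S, ideal a -> subtractive_ideal a.

(* Main.v *)
Require Import Defs.
From mathcomp Require Import all_boot all_order all_algebra.
From mathcomp Require Import boolp classical_sets.
Local Open Scope ring_scope.
Local Open Scope classical_set_scope.

Import GRing.Theory.

(** A 2-absorbing ideal contains the square of every element of its radical, and subtractivity
    polarizes this to all products of two such elements, so the square of [p] lies in [a]
    ([two_absorbing_radical_mul]). Dividedness makes [a] primary: an element of [p] is a multiple of
    any [y] outside [p] ([two_absorbing_primary]). The converse combines three uses of primariness
    with the inclusion of the square of [p] in [a] ([primary_two_absorbing]). *)

Lemma ideal0 (S : comNzSemiRingType) (a : set S) : ideal a -> a 0.
Proof. by case=> -[x ax] _ aM; rewrite -(mul0r x); apply: aM. Qed.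

Lemma ideal_sum (S : comNzSemiRingType) (a : set S) (n : nat) (f : 'I_n -> S) :
  ideal a -> (forall i, a (f i)) -> a (\sum_(i < n) f i).
Proof.
move=> ha af; apply: (big_ind a) => //; first exact: ideal0.
by case: ha.
Qed.

Lemma sub_radical (S : comNzSemiRingType) (a : set S) : a `<=` radical a.
Proof. by move=> x ax; exists 1%N; rewrite expr1. Qed.

Lemma ideal_prod_sub (S : comNzSemiRingType) (a I J : set S) :
  ideal a -> (forall x y, I x -> J y -> a (x * y)) -> ideal_prod I J `<=` a.
Proof.
move=> ha IJa z [n [u [v [Iu Jv ->]]]].
by apply: ideal_sum => // i; apply: IJa.
Qed.

Lemma mem_ideal_prod (S : comNzSemiRingType) (I J : set S) (x y : S) :
  I x -> J y -> ideal_prod I J (x * y).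
Proof.
move=> Ix Jy; exists 1%N, (fun=> x), (fun=> y); split=> //.
by rewrite big_ord1.
Qed.

(** Splitting [x ^+ n.+2] as [x * x * x ^+ n], 2-absorption yields either [x * x] or the lower power
    [x ^+ n.+1] in [a], so the exponent descends. *)
Lemma two_absorbing_radical_sqr (S : comNzSemiRingType) (a : set S) (x : S) :
  two_absorbing_ideal a -> radical a x -> a (x * x).
Proof.
move=> [[[_ _ aM] _] a2] [n]; elim: n => [|[|n] IHn].
- by rewrite expr0 => a1; rewrite -(mulr1 (x * x)); apply: aM.
- by rewrite expr1; apply: aM.
rewrite (exprS x n.+1) (exprS x n) mulrA => /a2[] //.
  by rewrite -exprS.
by rewrite -exprS.
Qed.

(* Apply 2-absorption to [x * y * (x + y)], using that [x * x] and [y * y] are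
   in [a]. *)
Lemma two_absorbing_radical_mul (S : comNzSemiRingType) (a : set S) (x y : S) :
  subtractive_ideal a -> two_absorbing_ideal a ->
  radical a x -> radical a y -> a (x * y).
Proof.
move=> [[_ aD aM] aB] a2 rx ry.
have axx := two_absorbing_radical_sqr _ _ _ a2 rx.
have ayy := two_absorbing_radical_sqr _ _ _ a2 ry.
have axy : a (x * y * (x + y)).
  rewrite mulrDr; apply: aD; last by rewrite -mulrA; apply: aM.
  by rewrite mulrAC mulrC; apply: aM.
(* If [y * (x + y)] or [x * (x + y)] is in [a], subtractivity cancels the square and leaves
   [x * y]. *)
case: a2 => _ /(_ _ _ _ axy)[] //.
  by rewrite mulrDr addrC (mulrC y x) => /aB; apply.
by rewrite mulrDr => /aB; apply.
Qed.

(* If [x * y] is in [a] and [y] is not in [p], then [x] lies in [p], hence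
   [x = t * y] because [p] is divided, and [t * y * y] is in [a]. *)
Lemma two_absorbing_primary (S : comNzSemiRingType) (p a : set S) :
  divided_prime_ideal p -> radical a = p -> two_absorbing_ideal a ->
  primary_ideal a.
Proof.
move=> [[_ pP] pdiv] rad a2; split=> [|x y axy]; first by case: a2.
have [py|npy] := pselect (p y); first by right; rewrite -rad in py.
left; have px : p x.
  by case: (pP x y) => //; rewrite -rad; apply: sub_radical.
have [/(_ _ px)[t _ tyx] _] := pdiv _ npy.
(* Two of the three outcomes are [t * y], which is [x]; the third, [y * y], would put [y] in [p]. *)
move: axy; rewrite -tyx; case: a2 => _ a2 /a2[] // ayy.
by case: npy; rewrite -rad; exists 2%N; rewrite expr2.
Qed.

(** Each factor of [x * y * z] is in the radical unless the product of the other two is in [a]; if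
    all three are, the inclusion puts [x * y] in [a]. *)
Lemma primary_two_absorbing (S : comNzSemiRingType) (a : set S) :
  primary_ideal a -> ideal_prod (radical a) (radical a) `<=` a ->
  two_absorbing_ideal a.
Proof.
move=> [apr aP] sub; split=> // x y z axyz.
have [?|rz] := aP (x * y) z axyz; first by constructor 1.
have [?|rx] := aP (y * z) x ltac:(by rewrite mulrC mulrA).
  by constructor 2.
have [?|ry] := aP (x * z) y ltac:(by rewrite mulrAC).
  by constructor 3.
by constructor 1; apply/sub/mem_ideal_prod.
Qed.

Theorem theorem3p10 (S : comNzSemiRingType) (p a : set S)
    (hS : subtractive_semiring S)
    (hp : divided_prime_ideal p) (hp0 : p <> [set 0])
    (ha : ideal a) (hrad : radical a = p) :
  two_absorbing_ideal a <->
  (primary_ideal_for p a /\ ideal_prod p p `<=` a).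
Proof.
split=> [a2|[[aP _]]]; last first.
  by rewrite -hrad; apply: primary_two_absorbing.
split; first by split=> //; exact: (two_absorbing_primary _ _ _ hp hrad a2).
(* As [a] is closed under sums, products of two elements of [p] suffice. *)
apply: ideal_prod_sub => // x y; rewrite -hrad.
by apply: two_absorbing_radical_mul => //; apply: hS.
Qed.
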